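(* Let $G$ be an Abelian group. Then every $n$-tuple $(a_1,\ldots,a_n)$ of (not necessarily distinct) elements of $G$ has the weighted discrete Pompeiu property with respect to the family of simple similarities of $G$.
   Context: A map $\phi\colon G\to G$ is a simple similarity of the Abelian group $G$ (written additively) if there are an element $a\in G$ and a positive integer $k$ such that $\phi(x)=a+k\cdot x$ for every $x\in G$. Let $\mathcal{F}$ be a family of functions mapping a set $X$ into itself. An $n$-tuple $(a_1,\ldots,a_n)$ of (not necessarily distinct) elements of $X$ has the weighted discrete Pompeiu property with respect to $\mathcal{F}$ if the following holds: whenever $c_1,\ldots,c_n$ are complex numbers with $\sum_{j=1}^n c_j\ne 0$ and $f\colon X\to\mathbb{C}$ is such that $\sum_{j=1}^n c_j f(\phi(a_j))=0$ for every $\phi\in\mathcal{F}$, then $f\equiv 0$. *)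

(* Defs.v *)
From mathcomp Require Import all_boot all_order all_algebra.
From mathcomp Require Import all_classical reals.
From mathcomp Require Import complex.

Set Implicit Arguments.
Unset Strict Implicit.
Unset Printing Implicit Defensive.

Import GRing.Theory.

Local Open Scope classical_set_scope.
Local Open Scope ring_scope.

Definition simple_similarities (G : zmodType) : set (G -> G) :=
  [set phi | exists (a : G) (k : nat),
     (0 < k)%N /\ forall x : G, phi x = a + x *+ k].
Arguments simple_similarities G : clear implicits.

(* The complex numbers are R[i], for R a model of the real numbers. *)
Definition weighted_discrete_pompeiu (R : realType) (X : Type)
    (F : set (X -> X)) (n : nat) (a : n.-tuple X) : Prop :=
  forall (c : 'I_n -> R[i]) (f : X -> R[i]),
    \sum_(j < n) c j != 0 ->
    (forall phi : X -> X, F phi -> \sum_(j < n) c j * f (phi (tnth a j)) = 0) ->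
    forall x : X, f x = 0.
Arguments weighted_discrete_pompeiu R {X} F {n} a.

(* Main.v *)
Require Import Defs.
From mathcomp Require Import all_boot all_order all_algebra.
From mathcomp Require Import all_classical reals.
From mathcomp Require Import complex.

Import GRing.Theory.

Local Open Scope ring_scope.

(** Write T_u for the translation operator (T_u f)(x) = f (x + u).  The
    hypothesis says that f satisfies sum_j c_j T_(a_j)^k f = 0 for all k > 0.
    If the T_(a_j) were distinct nonzero scalars, a Vandermonde argument would
    force every c_j to vanish; if some of them coincide, it forces the sums of
    the c_j over equal scalars to vanish, hence also their total sum.

    The same idea works for the operators themselves, without passing to
    characters of G (that is, without spectral analysis).  Eliminating all
    indices but j from the relations ([eliminate_terms]) yields
    c_j * prod_(i != j) (T_(a_j) - T_(a_i)) f = 0, and some c_j is nonzero.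
    So if f is nonzero, some partial product g is nonzero and is killed by one
    further factor T_(a_j) - T_(a_i).  The relations are stable under
    differences of translations ([annihilated_diff]), so g still satisfies
    them; but a_i and a_j act on g in the same way, so the term at i can be
    absorbed into the one at j ([merge_weightE]).  This removes an index while
    preserving the total weight, and induction on the number of indices
    concludes ([annihilated_eq0]).  All of this takes place over an arbitrary
    integral domain. *)

Section TranslationRelations.

Variables (K : idomainType) (G : zmodType) (I : finType).
Implicit Types (f g : G -> K) (u v x : G) (c : I -> K) (A : {set I}).

Definition diff u v f : G -> K := fun x => f (x + u) - f (x + v).

Variable a : I -> G.

Definition annihilated c A f : Prop :=
  forall b k, (0 < k)%N -> \sum_(j in A) c j * f (b + a j *+ k) = 0.

Lemma annihilated_diff c A u v f :
  annihilated c A f -> annihilated c A (diff u v f).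
Proof.
move=> fA b k k_gt0.
under eq_bigr => j _ do rewrite /diff mulrBr (addrAC b _ u) (addrAC b _ v).
by rewrite sumrB !fA // subrr.
Qed.

(** The product of the operators T_(a_j) - T_(a_l), for l in s. *)
Definition iter_diff (s : seq I) (j : I) f : G -> K :=
  foldr (fun l g => diff (a j) (a l) g) f s.

Lemma iter_diff_cons l s j f x : iter_diff (l :: s) j f x =
  iter_diff s j f (x + a j) - iter_diff s j f (x + a l).
Proof. by []. Qed.

Lemma annihilated_iter_diff c A s j f :
  annihilated c A f -> annihilated c A (iter_diff s j f).
Proof. by move=> fA; elim: s => //= l s; apply: annihilated_diff. Qed.

Lemma iter_diff_mem s j f x : j \in s -> iter_diff s j f x = 0.
Proof.
elim: s x => // l s IHs x; rewrite inE iter_diff_cons.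
by case/predU1P => [<-|js]; rewrite ?subrr // !IHs // subrr.
Qed.

(** Gaussian elimination as for a Vandermonde system: subtracting from the
    relation at exponent k + 1 the translate by a_l of the relation at
    exponent k applies T_(a_j) - T_(a_l) to the term at j, for every j. *)
Lemma annihilated_sum_iter_diff c A s f : annihilated c A f ->
  forall b k, (0 < k)%N ->
    \sum_(j in A) c j * iter_diff s j f (b + a j *+ k) = 0.
Proof.
move=> fA; elim: s => [|l s IHs] b k k_gt0; first exact: fA.
under eq_bigr => j _.
  rewrite iter_diff_cons mulrBr -[b + _ + a j]addrA -mulrSr (addrAC b _ (a l)).
  over.
by rewrite sumrB !IHs // subrr.
Qed.

Lemma eliminate_terms c A j f : annihilated c A f -> j \in A -> c j != 0 ->
  forall x, iter_diff (enum (A :\ j)) j f x = 0.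
Proof.
move=> fA jA cj0 x; set s := enum _.
have := annihilated_sum_iter_diff c A s f fA (x - a j) 1 isT.
rewrite (bigD1 j) //= big1 ?addr0 => [|i /andP[iA ij]]; last first.
  by rewrite iter_diff_mem ?mulr0 // mem_enum !inE ij.
by rewrite mulr1n subrK => /eqP; rewrite mulf_eq0 (negPf cj0) => /eqP.
Qed.

Definition merge_weight c i j : I -> K :=
  fun l => if l == j then c j + c i else c l.

Lemma merge_weightE c A i j (F : I -> K) :
  i \in A -> j \in A -> i != j -> F j = F i ->
  \sum_(l in A :\ i) merge_weight c i j l * F l = \sum_(l in A) c l * F l.
Proof.
move=> iA jA ij Fij; rewrite (big_setD1 i iA) /=.
have jAi : j \in A :\ i by rewrite !inE eq_sym ij.
rewrite !(big_setD1 j jAi) /= /merge_weight eqxx mulrDl Fij addrCA addrA.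
congr (_ + _); apply: eq_bigr => l.
by rewrite !inE => /andP[/negPf ->].
Qed.

Lemma diff_eq0_mulrn u v f : (forall x, diff u v f x = 0) ->
  forall k x, f (x + u *+ k) = f (x + v *+ k).
Proof.
move=> f0; elim=> [|k IHk] x; first by rewrite !mulr0n.
rewrite !mulrSr !addrA; have /eqP := f0 (x + u *+ k).
by rewrite subr_eq0 => /eqP ->; rewrite (addrAC x (u *+ k)) IHk addrAC.
Qed.

Lemma annihilated_merge c A i j f :
  i \in A -> j \in A -> i != j -> (forall x, diff (a j) (a i) f x = 0) ->
  annihilated c A f -> annihilated (merge_weight c i j) (A :\ i) f.
Proof.
move=> iA jA ij f0 fA b k k_gt0.
rewrite (merge_weightE c A i j (fun l => f (b + a l *+ k))) ?fA //.
exact: diff_eq0_mulrn.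
Qed.

(** Since each T_(a_j) - T_(a_i) is injective on solutions, the vanishing of
    their product on f given by [eliminate_terms] can be peeled off one factor
    at a time, the intermediate functions being solutions again. *)
Lemma annihilated_eq0 c A f :
  \sum_(j in A) c j != 0 -> annihilated c A f -> forall x, f x = 0.
Proof.
have [m] := ubnP #|A|; elim: m => // m IHm in c A f * => cardA c_neq0 fA.
have [j jA cj0] : exists2 j, j \in A & c j != 0.
  apply/exists_inP; apply: contraNT c_neq0 => /exists_inPn c0.
  by rewrite big1 // => j /c0/negPn/eqP.
(* A solution g in the kernel of T_(a_j) - T_(a_i) solves the system in
   which i is merged into j, so the induction hypothesis gives g = 0. *)
have diff_inj i g : i \in A :\ j -> annihilated c A g ->
    (forall x, diff (a j) (a i) g x = 0) -> forall x, g x = 0.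
  rewrite !inE => /andP[ij iA] gA g0.
  apply: (IHm (merge_weight c i j) (A :\ i)).
  - by move: cardA; rewrite (cardsD1 i) iA.
  - have := merge_weightE c A i j (fun=> 1) iA jA ij erefl.
    under eq_bigr do rewrite mulr1.
    by under [RHS]eq_bigr do rewrite mulr1; move=> ->.
  - exact: annihilated_merge.
have := eliminate_terms c A j f fA jA cj0.
have: {subset enum (A :\ j) <= A :\ j} by move=> i; rewrite mem_enum.
elim: (enum _) => [|i s IHs] sA //= s0; apply: IHs => [l ls|].
  by apply: sA; rewrite inE ls orbT.
apply: (diff_inj i) => //; first by apply: sA; rewrite mem_head.
exact: annihilated_iter_diff.
Qed.

End TranslationRelations.

Theorem proposition1p3 (R : realType) (G : zmodType) (n : nat)
    (a : n.-tuple G) :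
  weighted_discrete_pompeiu R (simple_similarities G) a.
Proof.
move=> c f c_neq0 fS.
apply: (annihilated_eq0 _ _ _ (tnth a) c [set: 'I_n]%SET).
  by under eq_bigl do rewrite inE.
move=> b k k_gt0; under eq_bigl do rewrite inE.
by apply: (fS (fun x => b + x *+ k)); exists b, k.
Qed.
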